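(* Let $G$ be a graph. Then $\hat{\varphi}(G) = 0$ if and only if $G$ is paw-free and perfect. Also, $\varphi(G) = 0$ if and only if $G$ is complete multipartite.
   Context: All graphs are finite, simple and undirected, with at least one vertex. $\chi$ denotes the chromatic number. For a proper vertex coloring $c$ of $G$ and an induced subgraph $H$ of $G$, let $c(H)$ be the set of colors used by $c$ on the vertices of $H$. Define $\varphi_c(G)=\max_{H}\,(|c(H)|-\chi(H))$ over all induced subgraphs $H$ of $G$, and $\hat{\varphi}_c(G)$ as the same maximum taken only over all connected induced subgraphs $H$ of $G$. Define $\varphi(G)=\min_c \varphi_c(G)$ and $\hat{\varphi}(G)=\min_c \hat{\varphi}_c(G)$, the minima over all proper colorings $c$ of $G$ (with any number of colors). The paw is the graph on 4 vertices consisting of a triangle together with one further vertex adjacent to exactly one vertex of the triangle; paw-free means having no induced subgraph isomorphic to the paw. A graph is perfect if every induced subgraph has chromatic number equal to its clique number. A graph is complete multipartite if its vertices can be partitioned into independent sets with any two vertices in different sets adjacent (a single part, i.e. an edgeless graph, is allowed). *)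

(* Defs.v *)
(* boolp only supplies the boolean reflection of an existential. *)
From mathcomp Require Import all_boot.
From mathcomp Require Import boolp.

Set Implicit Arguments.
Unset Strict Implicit.
Unset Printing Implicit Defensive.

(* The vertex set may be empty here, so that every set of vertices induces
   a graph; nonemptiness is required where it is needed. *)
Record graph := Graph {
  vertex :> finType;
  adj : rel vertex;
  adj_sym : symmetric adj;
  adj_irr : irreflexive adj }.

Section Induced.
Variables (G : graph) (H : {set G}).

Definition induced_adj : rel {x : G | x \in H} := fun x y => adj (val x) (val y).

Lemma induced_sym : symmetric induced_adj.
Proof. by move=> x y; rewrite /induced_adj adj_sym. Qed.

Lemma induced_irr : irreflexive induced_adj.
Proof. by move=> x; rewrite /induced_adj adj_irr. Qed.

Definition induced : graph := Graph induced_sym induced_irr.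
End Induced.

Definition isomorphic (G G' : graph) : Prop :=
  exists2 f : G -> G', bijective f & forall x y, adj (f x) (f y) = adj x y.

Definition connected (G : graph) : bool :=
  (0 < #|G|) && [forall x : G, forall y : G, connect (@adj G) x y].

Definition proper_coloring (G : graph) (C : eqType) (c : G -> C) : bool :=
  [forall x : G, forall y : G, adj x y ==> (c x != c y)].

Definition colorable (G : graph) (k : nat) : bool :=
  [exists c : {ffun G -> 'I_k}, proper_coloring c].

Lemma colorable_card (G : graph) : colorable G #|G|.
Proof.
apply/existsP; exists [ffun x => enum_rank x].
apply/forallP=> x; apply/forallP=> y; apply/implyP=> xy; rewrite !ffunE.
by apply: contraTneq xy => /enum_rank_inj ->; rewrite adj_irr.
Qed.

Lemma colorable_ex (G : graph) : exists k, colorable G k.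
Proof. by exists #|G|; exact: colorable_card. Qed.

Definition chi (G : graph) : nat := ex_minn (colorable_ex G).

Definition clique (G : graph) (K : {set G}) : bool :=
  [forall x in K, forall y in K, (x != y) ==> adj x y].

Definition omega (G : graph) : nat := \max_(K : {set G} | clique K) #|K|.

Definition perfect (G : graph) : Prop :=
  forall H : {set G}, H != set0 -> chi (induced H) = omega (induced H).

Definition num_colors (G : graph) (c : G -> nat) (H : {set G}) : nat :=
  size (undup [seq c x | x in H]).

(* Hence num_colors c H - chi (induced H), as used below, is never truncated
   when c is proper. *)
Lemma chi_le_num_colors (G : graph) (c : G -> nat) (H : {set G}) :
  proper_coloring c -> chi (induced H) <= num_colors c H.
Proof.
move=> pc; rewrite /chi; case: ex_minnP => k _; apply.
set s := undup [seq c x | x in H].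
have cs (x : induced H) : index (c (val x)) s < num_colors c H.
  by rewrite index_mem mem_undup map_f // mem_enum (valP x).
apply/existsP; exists [ffun x => Ordinal (cs x)].
apply/forallP=> x; apply/forallP=> y; apply/implyP=> xy; rewrite !ffunE.
have := forallP (forallP pc (val x)) (val y); rewrite (xy : adj (val x) (val y)) implyTb.
apply: contraNneq => /(congr1 val) /= eq_ix; apply/eqP.
have cin (z : induced H) : c (val z) \in s.
  by rewrite mem_undup map_f // mem_enum (valP z).
by have := congr1 (nth 0 s) eq_ix; rewrite !nth_index ?cin.
Qed.

Definition phi_col (G : graph) (c : G -> nat) : nat :=
  \max_(H : {set G} | H != set0) (num_colors c H - chi (induced H)).

Definition phi_hat_col (G : graph) (c : G -> nat) : nat :=
  \max_(H : {set G} | connected (induced H))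
     (num_colors c H - chi (induced H)).

Definition coloring_value (G : graph) (F : (G -> nat) -> nat) (n : nat) : bool :=
  `[< exists2 c : G -> nat, proper_coloring c & F c = n >].

Lemma coloring_value_ex (G : graph) (F : (G -> nat) -> nat) :
  exists n, coloring_value F n.
Proof.
pose c (x : G) : nat := enum_rank x.
exists (F c); apply/asboolP; exists c => //.
apply/forallP=> x; apply/forallP=> y; apply/implyP=> xy.
by apply: contraTneq xy => /val_inj /enum_rank_inj ->; rewrite adj_irr.
Qed.

(* The minimum of F over all proper colorings; the colors are natural numbers,
   so their number is not bounded in advance. *)
Definition min_coloring (G : graph) (F : (G -> nat) -> nat) : nat :=
  ex_minn (coloring_value_ex F).

Definition phi (G : graph) : nat := min_coloring (@phi_col G).

Definition phi_hat (G : graph) : nat := min_coloring (@phi_hat_col G).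

Definition paw_edges : seq (nat * nat) := [:: (0, 1); (0, 2); (1, 2); (0, 3)].

Definition paw_adj : rel 'I_4 := fun i j =>
  ((val i, val j) \in paw_edges) || ((val j, val i) \in paw_edges).

Lemma paw_sym : symmetric paw_adj.
Proof. by move=> i j; rewrite /paw_adj orbC. Qed.

Lemma paw_irr : irreflexive paw_adj.
Proof. by case=> [[|[|[|[|i]]]] lti]. Qed.

Definition paw : graph := Graph paw_sym paw_irr.

Definition paw_free (G : graph) : Prop :=
  forall H : {set G}, ~ isomorphic (induced H) paw.

Definition independent (G : graph) (A : {set G}) : bool :=
  [forall x in A, forall y in A, ~~ adj x y].

Definition complete_multipartite (G : graph) : Prop :=
  exists P : {set {set G}},
    [/\ partition P [set: G],
        forall A, A \in P -> independent A
      & forall A B, A \in P -> B \in P -> A != B ->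
          forall x y, x \in A -> y \in B -> adj x y].

(* Main.v *)
(* Everything rests on the proper colorings giving equal colors to the two ends
   of every induced path on three vertices.

   For such a coloring, a vertex adjacent to a maximum clique K of its component
   can be exchanged with the vertex of K of the same color; moving along paths,
   K meets all the colors of its component.  So every connected induced subgraph
   uses exactly omega colors, and the graph is perfect.

   Conversely, a component of a paw-free perfect graph is either triangle-free,
   hence bipartite, or every vertex misses exactly one vertex of a fixed maximum
   clique, which serves as its color. *)
Require Import Defs.
From mathcomp Require Import all_boot.
From mathcomp Require Import boolp.
From mathcomp Require Import zify.

Set Implicit Arguments.
Unset Strict Implicit.
Unset Printing Implicit Defensive.

(** * Colorings, cliques, and the numbers [chi] and [omega] *)

Definition ends_agree (G : graph) (c : G -> nat) : Prop :=
  forall x y z : G, adj x y -> adj y z -> ~~ adj x z -> c x = c z.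

Lemma proper_coloringP (G : graph) (C : eqType) (c : G -> C) :
  reflect (forall x y, adj x y -> c x != c y) (proper_coloring c).
Proof.
apply: (iffP forallP) => [pc x y|pc x]; first exact/implyP/(forallP (pc x)).
by apply/forallP => y; apply/implyP/pc.
Qed.

Lemma cliqueP (G : graph) (K : {set G}) :
  reflect {in K &, forall x y, x != y -> adj x y} (clique K).
Proof.
apply: (iffP forall_inP) => [cK x y xK yK|cK x xK].
  exact/implyP/(forall_inP (cK x xK)).
by apply/forall_inP => y yK; apply/implyP/cK.
Qed.

Lemma clique_setU1 (G : graph) (K : {set G}) (x : G) :
  clique K -> {in K, forall y, y != x -> adj x y} -> clique (x |: K).
Proof.
move=> /cliqueP cK xK; apply/cliqueP => a b.
rewrite !in_setU1 => /predU1P[->|aK] /predU1P[->|bK]; rewrite ?eqxx //.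
- by rewrite eq_sym; exact: xK.
- by rewrite adj_sym; exact: xK.
exact: cK.
Qed.

Lemma chi_colorable (G : graph) : colorable G (chi G).
Proof. by rewrite /chi; case: ex_minnP. Qed.

Lemma chi_le (G : graph) (c : G -> nat) (k : nat) :
  proper_coloring c -> (forall x, c x < k) -> chi G <= k.
Proof.
move=> /proper_coloringP pc ck; rewrite /chi; case: ex_minnP => m _; apply.
apply/existsP; exists [ffun x => Ordinal (ck x)].
apply/proper_coloringP => x y /pc; rewrite !ffunE; apply: contra.
by rewrite -val_eqE.
Qed.

Lemma clique_le_omega (G : graph) (K : {set G}) : clique K -> #|K| <= omega G.
Proof. by move=> cK; apply: (bigmax_sup K). Qed.

Lemma omega_le_chi (G : graph) : omega G <= chi G.
Proof.
have /existsP[f /proper_coloringP pf] := chi_colorable G.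
apply/bigmax_leqP => K /cliqueP cK.
rewrite -[chi G in X in _ <= X]card_ord -(card_in_imset (f := f)) ?max_card //.
move=> x y xK yK; apply: contra_eq => xy; exact/pf/cK.
Qed.

Lemma num_colors_le (G : graph) (c : G -> nat) (H : {set G}) (s : seq nat) :
  {in H, forall x, c x \in s} -> num_colors c H <= size s.
Proof.
move=> cs; apply: uniq_leq_size => [|i]; first exact: undup_uniq.
by rewrite mem_undup => /mapP[x]; rewrite mem_enum => /cs xs ->.
Qed.

Lemma le_num_colors (G : graph) (c : G -> nat) (H : {set G}) (s : seq G) :
  {subset s <= H} -> uniq (map c s) -> size s <= num_colors c H.
Proof.
move=> sH us; rewrite -(size_map c); apply: uniq_leq_size => // _ /mapP[x xs ->].
by rewrite mem_undup map_f // mem_enum sH.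
Qed.

(** * Vanishing of the minima and maxima *)

Lemma min_coloring_eq0 (G : graph) (F : (G -> nat) -> nat) :
  min_coloring F = 0 <-> exists2 c : G -> nat, proper_coloring c & F c = 0.
Proof.
rewrite /min_coloring; case: ex_minnP => m /asboolP vm mmin; split.
  by move=> m0; move: vm; rewrite m0.
by move=> v0; apply/eqP; rewrite -leqn0 mmin //; apply/asboolP.
Qed.

Lemma phi_col_eq0 (G : graph) (c : G -> nat) :
  phi_col c = 0 <->
  forall H : {set G}, H != set0 -> num_colors c H <= chi (induced H).
Proof.
split=> [/eqP|h].
  by rewrite -leqn0 => /bigmax_leqP h H /h; rewrite leqn0 subn_eq0.
by apply/eqP; rewrite -leqn0; apply/bigmax_leqP => H /h; rewrite leqn0 subn_eq0.
Qed.

Lemma phi_hat_col_eq0 (G : graph) (c : G -> nat) :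
  phi_hat_col c = 0 <->
  forall H : {set G}, connected (induced H) -> num_colors c H <= chi (induced H).
Proof.
split=> [/eqP|h].
  by rewrite -leqn0 => /bigmax_leqP h H /h; rewrite leqn0 subn_eq0.
by apply/eqP; rewrite -leqn0; apply/bigmax_leqP => H /h; rewrite leqn0 subn_eq0.
Qed.

(** * Components and maximum cliques *)

Definition component (G : graph) (v : G) : {set G} :=
  [set x | connect (@adj G) v x].

Lemma component_refl (G : graph) (v : G) : v \in component v.
Proof. by rewrite inE connect0. Qed.

Lemma component_adj (G : graph) (v x y : G) :
  x \in component v -> adj x y -> y \in component v.
Proof. by rewrite !inE => vx /connect1; exact: connect_trans. Qed.

(** Induction along a path from [u], peeled at its end, so that each step goes from a vertex already
    reached to a neighbor. The start need not be [v], since a maximum clique of the component may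
    avoid [v]. *)
Lemma component_ind (G : graph) (v u : G) (Q : G -> Prop) :
  u \in component v -> Q u ->
  (forall x y, x \in component v -> Q x -> adj x y -> Q y) ->
  {in component v, forall x, Q x}.
Proof.
move=> uv Qu Qadj x xv.
have /connectP[p] : connect (@adj G) u x.
  move: uv xv; rewrite !inE (sym_connect_sym (@adj_sym G) v).
  exact: connect_trans.
elim/last_ind: p x {xv} => [|p y IH] x /=; first by move=> _ ->.
rewrite rcons_path last_rcons => /andP[up py] ->.
apply: Qadj py; last exact: IH.
move: uv; rewrite !inE => /connect_trans; apply.
by apply/connectP; exists p.
Qed.

Lemma max_clique_ex (G : graph) (A : {set G}) (v : G) :
  v \in A ->
  exists u, exists K : {set G}, [/\ u \in K, K \subset A, clique K &
    forall K' : {set G}, K' \subset A -> clique K' -> #|K'| <= #|K|].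
Proof.
move=> vA; pose Q (K : {set G}) := (K \subset A) && clique K.
have Q1 : Q [set v].
  rewrite /Q sub1set vA; apply/cliqueP => x y.
  by rewrite !inE => /eqP -> /eqP ->; rewrite eqxx.
case: (arg_maxnP (fun K : {set G} => #|K|) Q1) => K /andP[KA cK] Kmax.
have : 0 < #|K| by have := Kmax _ Q1; rewrite cards1.
case/card_gt0P => u uK; exists u, K; split=> // K' K'A cK'.
by apply: Kmax; rewrite /Q K'A.
Qed.

(** Otherwise [x |: K] would be a larger clique inside [A]. *)
Lemma max_clique_nonadj (G : graph) (A K : {set G}) (x : G) :
  clique K -> K \subset A ->
  (forall K' : {set G}, K' \subset A -> clique K' -> #|K'| <= #|K|) ->
  x \in A -> x \notin K -> exists2 k, k \in K & ~~ adj x k.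
Proof.
move=> cK KA Kmax xA xK; apply/exists_inP; rewrite -[X in is_true X]negbK.
rewrite negb_exists_in; apply/negP => /forall_inP xadj.
have : #|x |: K| <= #|K|.
  apply: Kmax; first by rewrite subUset sub1set xA.
  by apply: clique_setU1 => // y yK _; rewrite -[adj x y]negbK xadj.
by rewrite cardsU1 xK ltnn.
Qed.

(** * Colorings that agree at the ends of induced paths *)

Lemma component_colors_clique (G : graph) (c : G -> nat) (v : G) :
  proper_coloring c -> ends_agree c ->
  exists2 K : {set G}, clique K &
    {in component v, forall x, exists2 k, k \in K & c x = c k}.
Proof.
move=> /proper_coloringP pc agree.
have [u [K [uK KA cK Kmax]]] := max_clique_ex (component_refl v).
exists K => //.
(* K' is K after exchanging vertices for others of the same color. *)
pose Q x := exists K' : {set G}, [/\ x \in K', K' \subset component v, clique K',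
  #|K'| = #|K| & {in K', forall y, exists2 k, k \in K & c y = c k}].
suff Qv : {in component v, forall x, Q x}.
  by move=> x /Qv[K' [xK' _ _ _]]; exact.
apply: (@component_ind _ _ u); first exact: (subsetP KA).
  by exists K; split=> // y yK; exists y.
move=> x y xv [K' [xK' K'A cK' sK' cov]] xy.
have [yK'|yK'] := boolP (y \in K'); first by exists K'.
have yv := component_adj xv xy.
(* [K'] is as large as [K], hence also maximum, so [y] misses some [k] in it; this [k] is exchanged
   for [y]. *)
have [|k kK' yk] := max_clique_nonadj cK' K'A _ yv yK'.
  by rewrite sK'.
(* [y], [x], [k] is an induced path: [x] differs from [k], being adjacent to [y]. *)
have cyk : c y = c k.
  have [xk|xk] := eqVneq x k; first by rewrite -xk adj_sym xy in yk.
  apply: (agree y x k) => //; first by rewrite adj_sym.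
  exact: (cliqueP _ cK').
exists (y |: (K' :\ k)); split.
- exact: setU11.
- rewrite subUset sub1set yv; exact: subset_trans (subsetDl _ _) K'A.
- apply: clique_setU1 => [|z].
    apply/cliqueP => a b /setD1P[_ aK'] /setD1P[_ bK'].
    exact: (cliqueP _ cK').
  move=> /setD1P[zk zK'] _.
  have /pc czk : adj z k by apply: (cliqueP _ cK').
  have [xz|xz] := eqVneq x z; first by rewrite -xz adj_sym.
  (* If [y] missed [z], the induced path [y], [x], [z] would give [z] the color of [y], which is
     that of [k], although [z] and [k] are adjacent. *)
  apply: contraNT czk => yz; rewrite -cyk; apply/eqP/esym.
  apply: (agree y x z) => //; first by rewrite adj_sym.
  exact: (cliqueP _ cK').
- by rewrite cardsU1 !inE (negPf yK') andbF /= -sK' [in RHS](cardsD1 k) kK'.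
- move=> z /setU1P[->|/setD1P[_ /cov //]].
  by have [k' k'K ck'] := cov k kK'; exists k' => //; rewrite cyk.
Qed.

(** Induced paths of [induced H] are induced in [G], so the coloring restricted to [H] inherits the
    hypothesis, and one clique carries all its colors. *)
Lemma ends_agree_num_colors (G : graph) (c : G -> nat) (H : {set G}) :
  proper_coloring c -> ends_agree c -> connected (induced H) ->
  num_colors c H <= omega (induced H).
Proof.
move=> /proper_coloringP pc agree /andP[/card_gt0P[v _] /forallP conn].
pose d (x : induced H) := c (val x).
have [||K cK cov] := @component_colors_clique (induced H) d v.
- by apply/proper_coloringP => x y; exact: pc.
- by move=> x y z; exact: agree.
apply: leq_trans (clique_le_omega cK).
rewrite cardE -(size_map d); apply: num_colors_le => x xH.
have /cov[k kK] : (Sub x xH : induced H) \in component v.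
  by rewrite inE (forallP (conn v)).
by rewrite {1}/d /= => ->; rewrite map_f // mem_enum.
Qed.

(** Different components may use different colors, so colors are renumbered in each: a vertex gets
    the position of its color in the list of colors of a clique covering its component. *)
Lemma ends_agree_chi (G : graph) (c : G -> nat) :
  proper_coloring c -> ends_agree c -> chi G = omega G.
Proof.
move=> pc agree; apply/eqP; rewrite eqn_leq omega_le_chi andbT.
have /fin_all_exists2[K cK cov] (v : G) := component_colors_clique v pc agree.
(* [root] picks one representative per component, so adjacent vertices share the same list. *)
pose s x := [seq c k | k in K (root (@adj G) x)].
have csym := sym_connect_sym (@adj_sym G).
have cs x : c x \in s x.
  have /cov[k kK ->] : x \in component (root (@adj G) x).
    by rewrite inE csym connect_root.
  by rewrite map_f // mem_enum.
apply: (@chi_le _ (fun x => index (c x) (s x))); last first.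
  move=> x; apply: leq_trans (clique_le_omega (cK (root (@adj G) x))).
  by rewrite cardE -(size_map c) index_mem.
apply/proper_coloringP => x y xy.
have sxy : s y = s x.
  by rewrite /s (rootP csym (connect1 xy)).
rewrite sxy; apply: contraTneq pc => /(congr1 (nth 0 (s x))).
rewrite !nth_index ?cs -?{1}sxy ?cs // => cxy.
by apply/negP => /proper_coloringP/(_ x y xy); rewrite cxy eqxx.
Qed.

Lemma ends_agree_perfect (G : graph) (c : G -> nat) :
  proper_coloring c -> ends_agree c -> perfect G.
Proof.
move=> /proper_coloringP pc agree H _.
apply: (@ends_agree_chi (induced H) (fun x => c (val x))).
  by apply/proper_coloringP => x y; exact: pc.
by move=> x y z; exact: agree.
Qed.

Lemma ends_agree_paw_free (G : graph) (c : G -> nat) :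
  proper_coloring c -> ends_agree c -> paw_free G.
Proof.
move=> /proper_coloringP pc agree H [f [g fK gK] fadj].
have gadj i j (lti : i < 4) (ltj : j < 4) :
    adj (val (g (Ordinal lti))) (val (g (Ordinal ltj))) =
    paw_adj (Ordinal lti) (Ordinal ltj).
  by rewrite -[LHS]/(@adj (induced H) _ _) -fadj !gK.
(* The triangle is 0, 1, 2 and the vertex 3 hangs from 0. The induced paths 3, 0, 1 and 3, 0, 2 give
   the adjacent vertices 1 and 2 the color of 3. *)
have /pc := gadj 1 2 isT isT.
rewrite -(agree (val (g (@Ordinal 4 3 isT))) (val (g (@Ordinal 4 0 isT)))) ?gadj //.
by rewrite (agree _ (val (g (@Ordinal 4 0 isT)))
                    (val (g (@Ordinal 4 2 isT)))) ?gadj ?eqxx.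
Qed.

(** * Coloring paw-free perfect graphs *)

(** Otherwise the four vertices induce a paw. [d] may coincide with [b] or [c]; it is then adjacent
    to the other one. *)
Lemma paw_free_adj (G : graph) (a b c d : G) :
  paw_free G -> adj a b -> adj a c -> adj b c -> adj a d -> adj d b || adj d c.
Proof.
move=> pf ab ac bc ad; rewrite -[_ || _]negbK negb_or; apply/negP => /andP[db dc].
have neq (x y : G) : adj x y -> x != y.
  by move=> xy; apply: contraTneq xy => ->; rewrite adj_irr.
(* The order follows [paw_edges]: [a] has degree three and [d] is pendant. *)
pose s := [:: a; b; c; d].
have us : uniq s.
  have bd : b != d by apply: contraNneq dc => <-.
  have cd : c != d by apply: contraNneq db => <-; rewrite adj_sym.
  by rewrite /= !inE !negb_or (neq _ _ ab) (neq _ _ ac) (neq _ _ ad) (neq _ _ bc) bd cd.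
pose H := [set x in s].
have sH (i : 'I_4) : nth a s i \in H by rewrite inE mem_nth.
pose g (i : paw) : induced H := Sub (nth a s i) (sH i).
have Hs (x : induced H) : val x \in s by move: (valP x); rewrite inE.
have ltf (x : induced H) : index (val x) s < 4 by rewrite index_mem.
pose f (x : induced H) : paw := Ordinal (ltf x).
have fK : cancel f g by move=> x; apply/val_inj; exact: nth_index.
have gK : cancel g f by move=> i; apply/val_inj; exact: index_uniq.
apply: (pf H); exists f; first by exists g.
move=> x y; rewrite -(fK x) -(fK y) !gK; move: (f x) (f y).
have [ba ca cb da] : [/\ adj b a, adj c a, adj c b & adj d a].
  by split; rewrite adj_sym.
have [bd cd] : ~~ adj b d /\ ~~ adj c d by split; rewrite adj_sym.
case=> [[|[|[|[|i]]]] lti] // [[|[|[|[|j]]]] ltj] //;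
  rewrite [RHS]/adj /= /induced_adj /= ?adj_irr //;
  by rewrite ?(ab, ac, bc, ad, ba, ca, cb, da,
               negPf db, negPf dc, negPf bd, negPf cd).
Qed.

(** The component is in fact complete multipartite, which yields properness and agreement at once.
    The color of a vertex is the only vertex of [K] that it misses; a vertex of [K] misses
    itself. *)
Lemma paw_free_component_coloring (G : graph) (A K : {set G}) (u : G) :
  paw_free G -> u \in K -> K \subset A -> clique K -> 2 < #|K| ->
  (forall K' : {set G}, K' \subset A -> clique K' -> #|K'| <= #|K|) ->
  A = component u ->
  exists c : G -> nat,
    {in A &, forall x y, (c x == c y) = ~~ adj x y}.
Proof.
move=> pf uK KA cK K3 Kmax defA.
have cliqueK := cliqueP _ cK.
have other2 k : exists p q, [/\ p \in K, q \in K, p != k, q != k & p != q].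
  have : 1 < #|K :\ k| by move: K3; rewrite (cardsD1 k); case: (k \in K); lia.
  case/card_gt1P => p [q [/setD1P[pk pK] /setD1P[qk qK] pq]].
  by exists p, q.
pose Q x k := [/\ k \in K, ~~ adj x k & {in K, forall y, y != k -> adj x y}].
have exQ : {in A, forall x, exists k, Q x k}.
  rewrite defA; apply: (component_ind (component_refl u)).
    exists u; split=> //; first by rewrite adj_irr.
    by move=> y yK yu; apply: cliqueK => //; rewrite eq_sym.
  move=> w x wA [k [kK wk wK]] wx.
  have xA : x \in A by rewrite defA (component_adj wA).
  have [xK|xK] := boolP (x \in K).
    exists x; split=> //; first by rewrite adj_irr.
    by move=> y yK yx; apply: cliqueK => //; rewrite eq_sym.
  (* The neighbor [w] of [x] forms a triangle with two vertices of [K] other than [k], so [x] is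
     adjacent to one of them. *)
  have [r rK xr] : exists2 r, r \in K & adj x r.
    have [p [q [pK qK pk qk pq]]] := other2 k.
    have := paw_free_adj pf (wK p pK pk) (wK q qK qk) (cliqueK _ _ pK qK pq) wx.
    by case/orP; [exists p | exists q].
  have [k' k'K xk'] := max_clique_nonadj cK KA Kmax xA xK.
  (* In the triangle [r], [y], [k'], with [x] attached at [r], the missing edge to [k'] forces the
     one to [y]. *)
  exists k'; split=> // y yK yk'; have [<- //|ry] := eqVneq r y.
  have rk' : r != k' by apply: contraTneq xr => ->.
  have := paw_free_adj (d := x) pf (cliqueK _ _ rK yK ry) (cliqueK _ _ rK k'K rk')
    (cliqueK _ _ yK k'K yk'); rewrite [adj r x]adj_sym xr => /(_ isT).
  by rewrite (negPf xk') orbF.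
have /fin_all_exists[f fQ] (x : G) : exists k, x \in A -> Q x k.
  by have [/exQ[k]|] := boolP (x \in A); [exists k | exists u].
exists (fun x => val (enum_rank (f x))) => x y xA yA.
rewrite (inj_eq val_inj) (inj_eq enum_rank_inj).
have [xK xf xadj] := fQ x xA; have [yK yf yadj] := fQ y yA.
have [fxy|fxy] := eqVneq (f x) (f y).
  (* Adjacent [x] and [y] missing the same vertex could both replace it in [K], giving a larger
     clique. *)
  apply/esym/negP => xy.
  have notf z : z \in K -> ~~ adj z (f x) -> z = f x.
    by move=> zK; apply: contraNeq => /(cliqueK _ _ zK xK).
  have cx : clique (x |: (K :\ f x)).
    apply: clique_setU1 => [|z /setD1P[zf zK] _]; last exact: xadj.
    by apply/cliqueP => p q /setD1P[_ pK] /setD1P[_ qK]; exact: cliqueK.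
  have cxy : clique (y |: (x |: (K :\ f x))).
    apply: clique_setU1 => // z /setU1P[-> _|]; first by rewrite adj_sym.
    by move=> /setD1P[zf zK] _; apply: yadj; rewrite -?fxy.
  have xK' : x \notin K :\ f x.
    by apply/negP => /setD1P[xfx /notf-/(_ xf)/eqP]; rewrite (negPf xfx).
  have yK' : y \notin x |: (K :\ f x).
    apply/negP => /setU1P[yx|]; first by rewrite yx adj_irr in xy.
    rewrite -fxy in yf.
    by move/setD1P=> [yfx /notf-/(_ yf)/eqP]; rewrite (negPf yfx).
  have sxy : y |: (x |: (K :\ f x)) \subset A.
    by rewrite !subUset !sub1set xA yA (subset_trans (subsetDl _ _) KA).
  have := Kmax _ sxy cxy.
  by rewrite cardsU1 yK' cardsU1 xK' (cardsD1 (f x) K) xK ltnn.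
apply/esym/negbF; have [p [q [pK qK pf' qf pq]]] := other2 (f x).
(* A third vertex [z] of [K] is adjacent to [x], [y] and [f y]. In the triangle [z], [x], [f y],
   with [y] attached at [z] and missing [f y], the vertices [x] and [y] must be adjacent. *)
have [z zK [zx zy]] : exists2 z, z \in K & z != f x /\ z != f y.
  have [pfy|] := eqVneq p (f y); last by exists p.
  by exists q; rewrite -?pfy 1?[q == p]eq_sym.
have xfy := xadj _ yK; rewrite eq_sym fxy in xfy; move: xfy => /(_ isT) xfy.
rewrite -[adj x y]negbK; apply/negP => xy.
have zfy := cliqueK _ _ zK yK zy.
have := paw_free_adj pf (c := f y) (a := z) (b := x) (d := y).
rewrite adj_sym xadj // zfy xfy adj_sym yadj // [adj y x]adj_sym (negPf xy) (negPf yf).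
by move=> /(_ isT isT isT isT).
Qed.

Lemma chi_le2_component_coloring (G : graph) (A : {set G}) :
  chi (induced A) <= 2 ->
  exists c : G -> nat, {in A, forall x, c x < 2} /\
    {in A &, forall x y, adj x y -> c x != c y}.
Proof.
move=> chi2; have /existsP[f /proper_coloringP pf] := chi_colorable (induced A).
(* The value 0 outside [A] is arbitrary. *)
exists (fun x => oapp (fun u : {x | x \in A} => val (f u)) 0 (insub x)).
split=> [x xA|x y xA yA xy]; rewrite !insubT /=.
  exact: leq_trans (ltn_ord _) chi2.
by rewrite (inj_eq val_inj); apply: pf.
Qed.

Lemma ends_agree_ex (G : graph) :
  paw_free G -> perfect G ->
  exists2 c : G -> nat, proper_coloring c & ends_agree c.
Proof.
move=> pf perf.
have /fin_all_exists[c cP] (r : G) : exists c : G -> nat,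
    {in component r &, forall x y, adj x y -> c x != c y} /\
    {in component r & &, forall x y z,
      adj x y -> adj y z -> ~~ adj x z -> c x = c z}.
  have [u [K [uK KA cK Kmax]]] := max_clique_ex (component_refl r).
  have defA : component r = component u.
    apply/setP => x; have := subsetP KA u uK; rewrite !inE.
    by move/(same_connect (sym_connect_sym (@adj_sym G))) ->.
  have [K3|K2] := ltnP 2 #|K|.
    have [c cP] := paw_free_component_coloring pf uK KA cK K3 Kmax defA.
    exists c; split=> [x y xA yA|x y z xA yA zA _ _]; first by rewrite cP ?negbK.
    by rewrite -cP // => /eqP.
  have /chi_le2_component_coloring[c [c2 cP]] : chi (induced (component r)) <= 2.
    rewrite perf; last by apply/set0Pn; exists r; exact: component_refl.
    (* Cliques of the induced component are cliques of [G] inside it, so the bound on [K] applies to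
       them. *)
    apply/bigmax_leqP => K' /cliqueP cK'; apply: leq_trans K2.
    rewrite -(card_imset _ val_inj); apply: Kmax.
      by apply/subsetP => _ /imsetP[x _ ->]; exact: valP.
    apply/cliqueP => _ _ /imsetP[x xK ->] /imsetP[y yK ->] xy.
    by apply: (cK' x y).
  exists c; split=> // x y z xA yA zA xy yz _.
  have := cP _ _ xA yA xy; have := cP _ _ yA zA yz.
  (* With only two colors, [x] and [z] both have the one that [y] lacks. *)
  by have := c2 x xA; have := c2 y yA; have := c2 z zA; lia.
have csym := sym_connect_sym (@adj_sym G).
have in_root x : x \in component (root (@adj G) x).
  by rewrite inE csym connect_root.
have root_adj x y : adj x y -> root (@adj G) x = root (@adj G) y.
  by move/connect1/(rootP csym).
(* Both properties compare only vertices of one component, so the colorings of the components can be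
   glued. *)
exists (fun x => c (root (@adj G) x) x).
  apply/proper_coloringP => x y xy; have := in_root y.
  rewrite -(root_adj x y xy) => yx; exact: (cP _).1.
move=> x y z xy yz; have := in_root x; have := in_root z.
rewrite -(root_adj y z yz) -(root_adj x y xy) => zA xA.
have [_ agree] := cP (root (@adj G) x).
by apply: (agree x y z) => //; exact: component_adj xA xy.
Qed.

(** * Colorings of value zero *)

Lemma connected_star (G : graph) (H : {set G}) (y : G) :
  y \in H -> {in H, forall x, x != y -> adj x y} -> connected (induced H).
Proof.
move=> yH Hy; pose y' : induced H := Sub y yH.
have xy (x : induced H) : connect (@adj (induced H)) x y'.
  have [->|xy] := eqVneq x y'; first exact: connect0.
  by apply: connect1; apply: Hy; [exact: valP | exact: xy].
apply/andP; split; first by apply/card_gt0P; exists y'.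
apply/forallP => x; apply/forallP => z; apply: connect_trans (xy x) _.
by rewrite (sym_connect_sym (@adj_sym _)) xy.
Qed.

(** An induced path with ends of different colors shows three colors, although it is connected and
    two suffice: one for [y], one for both ends. *)
Lemma phi_hat_col_ends_agree (G : graph) (c : G -> nat) :
  proper_coloring c -> phi_hat_col c = 0 -> ends_agree c.
Proof.
move=> /proper_coloringP pc /phi_hat_col_eq0 ch x y z xy yz xz.
apply/eqP; rewrite -[_ == _]negbK; apply/negP => cxz.
pose H := [set x; y; z].
have sH : {subset [:: x; y; z] <= H} by move=> t; rewrite !inE orbA.
have /ch : connected (induced H).
  apply: (@connected_star _ _ y) => [|t]; first by rewrite !inE eqxx orbT.
  rewrite !inE -orbA => /or3P[] /eqP -> //; first by rewrite eqxx.
  by rewrite adj_sym yz.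
apply/negP; rewrite -ltnNge; apply: leq_trans (le_num_colors sH _); last first.
  by rewrite /= !inE !negb_or cxz !pc.
have adj_y : {in H &, forall s t, adj s t -> (s == y) != (t == y)}.
  have neq (s t : G) : adj s t -> s == t = false.
    by move=> st; apply: contraTF st => /eqP->; rewrite adj_irr.
  move=> s t; rewrite !inE -!orbA => /or3P[] /eqP-> /or3P[] /eqP->;
    rewrite ?eqxx ?adj_irr ?(neq _ _ xy) 1?[z == y]eq_sym ?(neq _ _ yz) //.
    by rewrite (negPf xz).
  by rewrite adj_sym (negPf xz).
apply: (@chi_le (induced H) (fun t => val t == y)) => [|t]; last by case: eqP.
apply/proper_coloringP => s t /(adj_y _ _ (valP s) (valP t)).
by case: (val s == y); case: (val t == y).
Qed.

(** Without connectedness, a nonadjacent pair is itself a test set: one color suffices for it, so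
    [c] cannot use two. *)
Lemma phi_col_adj (G : graph) (c : G -> nat) (x y : G) :
  proper_coloring c -> phi_col c = 0 -> adj x y = (c x != c y).
Proof.
move=> /proper_coloringP pc /phi_col_eq0 ch.
apply/idP/idP => [/pc //|cxy]; rewrite -[adj x y]negbK; apply/negP => xy.
pose H := [set x; y].
have sH : {subset [:: x; y] <= H} by move=> t; rewrite !inE.
have /ch : H != set0 by apply/set0Pn; exists x; rewrite !inE eqxx.
apply/negP; rewrite -ltnNge; apply: leq_trans (le_num_colors sH _); last first.
  by rewrite /= inE cxy.
apply: (@chi_le (induced H) (fun=> 0)) => //; apply/proper_coloringP => s t st.
suff : {in H &, forall u v, ~~ adj u v} by move/(_ _ _ (valP s) (valP t))/negP.
move=> u v; rewrite !inE => /orP[] /eqP-> /orP[] /eqP->; rewrite ?adj_irr //.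
by rewrite adj_sym.
Qed.

(** * Complete multipartite graphs *)

(** A class of any proper coloring [f] of [induced H] is independent, so [c] is constant on it and
    has no more colors than [f]. *)
Lemma num_colors_le_chi (G : graph) (c : G -> nat) (H : {set G}) :
  (forall x y, c x != c y -> adj x y) -> num_colors c H <= chi (induced H).
Proof.
move=> ch; have /existsP[f /proper_coloringP pf] := chi_colorable (induced H).
have fc u v : f u = f v -> c (val u) = c (val v).
  by move=> fuv; apply: contra_eq fuv => /ch; exact: pf.
(* [g] sends a class of [f] to its color under [c]; 0 stands in for an empty class. *)
pose g i := oapp (fun u : induced H => c (val u)) 0 [pick u | f u == i].
rewrite -[chi _]size_enum_ord -(size_map g); apply: num_colors_le => x xH.
apply/mapP; exists (f (Sub x xH)); first by rewrite mem_enum.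
rewrite /g; case: pickP => [u /eqP /fc /= -> //|/(_ (Sub x xH))].
by rewrite eqxx.
Qed.

Lemma complete_multipartiteP (G : graph) :
  complete_multipartite G <->
  exists c : G -> nat, forall x y, adj x y = (c x != c y).
Proof.
split=> [[P [/and3P[/eqP covP tiP _] indep joined]]|[c cP]].
  have inP x : pblock P x \in P by rewrite pblock_mem // covP inE.
  have in_block x : x \in pblock P x by rewrite mem_pblock covP inE.
  exists (fun x => val (enum_rank (pblock P x))) => x y.
  rewrite (inj_eq val_inj) (inj_eq enum_rank_inj).
  have [xy|xy] := eqVneq (pblock P x) (pblock P y); last exact: joined xy _ _ _ _.
  have /forall_inP/(_ x (in_block x))/forall_inP := indep _ (inP x).
  by move=> /(_ y); rewrite {1}xy => /(_ (in_block y))/negPf.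
(* Blocks are indexed by vertices, so none is empty, as [partition] demands. *)
pose P := [set [set y | c y == c x] | x in [set: G]].
exists P; split.
- apply/and3P; split.
  + apply/eqP/setP => x; rewrite inE; apply/bigcupP.
    by exists [set y | c y == c x]; rewrite ?inE // imset_f ?inE.
  + apply/trivIsetP => _ _ /imsetP[x _ ->] /imsetP[y _ ->].
    apply: contraNT => /pred0Pn[z /=]; rewrite !inE => /andP[/eqP <- /eqP zy].
    by rewrite zy.
  + apply/imsetP => -[x _ /setP/(_ x)]; rewrite !inE eqxx //.
- move=> _ /imsetP[z _ ->]; apply/forall_inP => x xz; apply/forall_inP => y.
  by move: xz; rewrite !inE cP negbK => /eqP -> /eqP ->.
move=> _ _ /imsetP[u _ ->] /imsetP[v _ ->] uv x y; rewrite !inE cP.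
move=> /eqP -> /eqP ->; apply: contraNneq uv => ->; exact: eqxx.
Qed.

Theorem theorem5p2 (G : graph) (G_gt0 : 0 < #|G|) :
  (phi_hat G = 0 <-> paw_free G /\ perfect G) /\
  (phi G = 0 <-> complete_multipartite G).
Proof.
split; split.
- move=> /min_coloring_eq0[c pc c0].
  have agree := phi_hat_col_ends_agree pc c0.
  by split; [exact: ends_agree_paw_free agree | exact: ends_agree_perfect agree].
- move=> [pf perf]; have [c pc agree] := ends_agree_ex pf perf.
  apply/min_coloring_eq0; exists c => //; apply/phi_hat_col_eq0 => H conn.
  exact: leq_trans (ends_agree_num_colors pc agree conn) (omega_le_chi _).
- move=> /min_coloring_eq0[c pc c0]; apply/complete_multipartiteP.
  by exists c => x y; exact: phi_col_adj.
move=> /complete_multipartiteP[c cP]; apply/min_coloring_eq0; exists c.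
  by apply/proper_coloringP => x y; rewrite cP.
by apply/phi_col_eq0 => H _; apply: num_colors_le_chi => x y; rewrite cP.
Qed.
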